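(* Let ${\boldsymbol{a}}_0\in\mathbb{R}^n_{>0}$ and let ${\boldsymbol{a}}=(a_1,\dots,a_n)\in\mathbb{R}^n$ be such that $\operatorname{Flow}_n({\boldsymbol{a}})$ is non-empty. Let $l$ be the critical position of ${\boldsymbol{a}}$. Then $\operatorname{Flow}_n({\boldsymbol{a}})$ is a deformation of $\operatorname{Tes}_n({\boldsymbol{a}}_0)$ if and only if $l=n$ or $a_i\ge0$ for all $l+2\le i\le n$.
   Context: $\mathbb{U}(n)$ is the real vector space of upper triangular $n\times n$ real matrices $\boldsymbol{m}=(m_{i,j})_{1\le i\le j\le n}$; the $i$-th hook sum is $\eta_i(\boldsymbol{m})=m_{i,i}+\sum_{i<j\le n}m_{i,j}-\sum_{1\le j<i}m_{j,i}$ and $\boldsymbol{\eta}(\boldsymbol{m})=(\eta_1(\boldsymbol{m}),\dots,\eta_n(\boldsymbol{m}))$. For ${\boldsymbol{a}}\in\mathbb{R}^n$, the flow polytope is $\operatorname{Flow}_n({\boldsymbol{a}})=\{\boldsymbol{m}\in\mathbb{U}(n):\boldsymbol{\eta}(\boldsymbol{m})={\boldsymbol{a}},\ m_{i,j}\ge0\text{ for all }1\le i\le j\le n\}$ (it is non-empty iff $\sum_{i=1}^k a_i\ge0$ for all $1\le k\le n$). For ${\boldsymbol{a}}\in\mathbb{R}^n_{\ge0}$ the Tesler polytope is $\operatorname{Tes}_n({\boldsymbol{a}})=\operatorname{Flow}_n({\boldsymbol{a}})$. Critical position: for $1\le i\le n-1$, the entry $a_i$ is called a voided positive entry if $a_i>0$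 and $a_i+a_{i+1}=0$. The critical position of ${\boldsymbol{a}}$ is the smallest $l\in\{1,\dots,n-1\}$ such that $a_l>0$ and $a_l$ is not voided, if such $l$ exists; otherwise the critical position is $l=n$. Deformation: a polytope $Q$ is a deformation of a polytope $P$ if the normal fan of $P$ refines the normal fan of $Q$. (Equivalently, with $L_n:\boldsymbol{m}\mapsto\boldsymbol{\eta}(\boldsymbol{m})$ and $P_n$ the projection deleting the $(n,n)$ entry: $Q$ is a deformation of $\operatorname{Tes}_n({\boldsymbol{a}}_0)$ iff there are ${\boldsymbol{a}}\in\mathbb{R}^n$ and real numbers $\tilde b_{i,j}$, $(i,j)\ne(n,n)$, such that $Q=\{\boldsymbol{m}:\boldsymbol{\eta}(\boldsymbol{m})={\boldsymbol{a}},\ m_{i,j}\ge-\tilde b_{i,j}\ \forall (i,j)\neq(n,n)\}$ with each inequality attained with equality somewhere on $Q$, and for each vertex ${\boldsymbol{v}}$ of $\operatorname{Tes}_n({\boldsymbol{a}}_0)$ the set of points of $Q$ with $m_{i,j}=-\tilde b_{i,j}$ for all $(i,j)\neq(n,n)$ with $v_{i,j}=0$ is a single vertex of $Q$.) *)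

(* Defs.v *)
From HB Require Import structures.
From mathcomp Require Import all_boot all_order all_algebra.
From mathcomp Require Import boolp classical_sets reals.

Set Implicit Arguments.
Unset Strict Implicit.
Unset Printing Implicit Defensive.

Import Order.TTheory GRing.Theory Num.Theory.

Local Open Scope classical_set_scope.
Local Open Scope ring_scope.

(* [is_trig_mx] means lower triangular in MathComp, hence the transpose. *)
Definition upper_trig (R : realType) (n : nat) : {pred 'M[R]_n} :=
  fun m => is_trig_mx m^T.

Fact upper_trig_submod_closed (R : realType) (n : nat) :
  submod_closed (@upper_trig R n).
Proof.
split=> [|c A B /is_trig_mxP hA /is_trig_mxP hB].
  by apply/is_trig_mxP => i j _; rewrite !mxE.
apply/is_trig_mxP => i j ij; move: (hA i j ij) (hB i j ij).
by rewrite !mxE => -> ->; rewrite mulr0 addr0.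
Qed.

HB.instance Definition _ (R : realType) (n : nat) :=
  GRing.isSubmodClosed.Build R 'M[R]_n (@upper_trig R n)
    (@upper_trig_submod_closed R n).

Record upper_mx (R : realType) (n : nat) : Type := UpperMx {
  upper_mx_val :> 'M[R]_n;
  upper_mx_valP : upper_mx_val \in @upper_trig R n
}.

HB.instance Definition _ (R : realType) (n : nat) :=
  [isSub for @upper_mx_val R n].
HB.instance Definition _ (R : realType) (n : nat) :=
  [Choice of upper_mx R n by <:].
HB.instance Definition _ (R : realType) (n : nat) :=
  [SubChoice_isSubLmodule of upper_mx R n by <:].

Section Polytopes.
Variables (R : realType) (V : lmodType R).
Implicit Types (P Q F : set V) (c : {scalar V}) (S T : set (set {scalar V})).

Definition max_face P c : set V :=
  [set x | P x /\ forall y, P y -> c y <= c x].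

Definition nonempty_face P F : Prop :=
  F !=set0 /\ exists c, F = max_face P c.

Definition normal_cone P F : set {scalar V} :=
  [set c | forall x y, F x -> P y -> c y <= c x].

(* The fan lives in the full dual space: if [P] is not full-dimensional, its
   cones all contain the functionals that are constant on [P]. *)
Definition normal_fan P : set (set {scalar V}) :=
  [set C | exists2 F, nonempty_face P F & C = normal_cone P F].

Definition refines S T : Prop :=
  (forall C, S C -> exists2 D, T D & C `<=` D) /\
  \bigcup_(C in S) C = \bigcup_(D in T) D.

Definition is_deformation Q P : Prop := refines (normal_fan P) (normal_fan Q).

End Polytopes.

(* Indices i : 'I_n are 0-based: the entry a_k of the mathematical text
   (1 <= k <= n) is [a 0 i] with k = i.+1. *)
Section FlowPolytopes.
Variables (R : realType) (n : nat).
Implicit Types (a : 'rV[R]_n) (m : upper_mx R n) (i j : 'I_n).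

Definition hook_sum m i : R :=
  m i i + \sum_(j < n | (i < j)%N) m i j - \sum_(j < n | (j < i)%N) m j i.

Definition hook_sums m : 'rV[R]_n := \row_(i < n) hook_sum m i.

Definition Flow a : set (upper_mx R n) :=
  [set m | hook_sums m = a /\ forall i j, (i <= j)%N -> 0 <= m i j].

(* Only meant for [a] with nonnegative entries. *)
Definition Tes a : set (upper_mx R n) := Flow a.

Definition voided_positive a i : bool :=
  (0 < a 0 i) && [exists j : 'I_n, (j == i.+1 :> nat) && (a 0 i + a 0 j == 0)].

(* The 1-based critical position, an element of {1, ..., n} when n > 0; the
   positions i.+1 over which the minimum is taken are at most n - 1. *)
Definition critical_position a : nat :=
  \big[minn/n]_(i < n | [&& (i.+1 < n)%N, 0 < a 0 i & ~~ voided_positive a i])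
    i.+1.

End FlowPolytopes.

(* Main.v *)
(* Read [m] as a flow on the nodes 1, ..., n with edges i -> j of flow m_ij for
   i < j and an edge from i to a sink of flow m_ii; node i has netflow a_i. For
   positive a_0 the vertices of Tes(a_0) are the flows that leave each node along
   a single edge i -> f i, and by linear programming duality the normal cone of
   such a vertex is generated, modulo functionals that are constant on flows of
   given netflow, by the functionals -m_ij with j != f i. Hence Flow(a) is a
   deformation of Tes(a_0) iff for each such f some flow in Flow(a) minimizes all
   the entries off f simultaneously.

   That in turn holds iff a_(i+1) < 0 forces a_1 + ... + a_(i-1) = 0. If this
   condition holds, then Flow(a) is the translate by b of a Tesler polytope, where
   b_(i,i+1) = max(0, -a_(i+1)) and b vanishes elsewhere. If it fails at i, take
   the f that passes everything on to the next node before i and sends everything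
   to the sink from i on: a flow minimal off f uses both i-1 -> i and i -> i+1, so
   the shortcut i-1 -> i+1 lowers its entry (i, i+1). The condition on partial
   sums is equivalent to the condition on the critical position. *)
Require Import Defs.
From HB Require Import structures.
From mathcomp Require Import all_boot all_order all_algebra.
From mathcomp Require Import boolp classical_sets reals.
From mathcomp Require Import ring lra zify.

Set Implicit Arguments.
Unset Strict Implicit.
Unset Printing Implicit Defensive.

Import Order.TTheory GRing.Theory Num.Theory.

Local Open Scope classical_set_scope.
Local Open Scope ring_scope.

(** * Coordinates and linear functionals on upper triangular matrices *)

Section UpperMatrices.
Variables (R : realType) (n : nat).
Implicit Types (m : upper_mx R n) (i j : 'I_n) (g : 'I_n -> 'I_n -> R).

Lemma upper_mx_eq0 m i j : (j < i)%N -> m i j = 0.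
Proof. by case: m => m /= /is_trig_mxP h ji; move: (h _ _ ji); rewrite mxE. Qed.

Fact to_upper_subproof g :
  \matrix_(i, j) (if (i <= j)%N then g i j else 0) \in @upper_trig R n.
Proof. by apply/is_trig_mxP => i j ij; rewrite !mxE leqNgt ij. Qed.

Definition to_upper g : upper_mx R n := UpperMx (to_upper_subproof g).

Lemma to_upperE g i j : to_upper g i j = if (i <= j)%N then g i j else 0.
Proof. by rewrite mxE. Qed.

Lemma upper_mxP m m' : (forall i j, m i j = m' i j) -> m = m'.
Proof. by move=> h; apply/val_inj/matrixP. Qed.

Definition unit_upper i j : upper_mx R n :=
  to_upper (fun k l => ((k == i) && (l == j))%:R).

Lemma upper_mxD m m' i j : (m + m') i j = m i j + m' i j.
Proof. by rewrite [LHS]mxE. Qed.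

Lemma upper_mxZ x m i j : (x *: m) i j = x * m i j.
Proof. by rewrite [LHS]mxE. Qed.

Lemma upper_mx_sum I (s : seq I) (P : pred I) (F : I -> upper_mx R n) i j :
  (\sum_(k <- s | P k) F k) i j = \sum_(k <- s | P k) F k i j.
Proof.
apply: (big_morph (fun m : upper_mx R n => m i j)) => [m m'|].
  by rewrite upper_mxD.
by rewrite mxE.
Qed.

Lemma upper_mx_decomp m : m = \sum_i \sum_j m i j *: unit_upper i j.
Proof.
apply: upper_mxP => k l; rewrite upper_mx_sum (big_only1 k) //.
  rewrite upper_mx_sum (big_only1 l) //.
    rewrite upper_mxZ to_upperE !eqxx.
    by case: leqP => [_|/upper_mx_eq0 ->]; rewrite ?mulr1 ?mulr0.
  move=> j jl _; rewrite upper_mxZ to_upperE eqxx eq_sym (negbTE jl).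
  by rewrite if_same mulr0.
move=> i ik _; rewrite upper_mx_sum big1 // => j _.
by rewrite upper_mxZ to_upperE eq_sym (negbTE ik) if_same mulr0.
Qed.

Lemma scalarE (c : {scalar upper_mx R n}) m :
  c m = \sum_i \sum_j c (unit_upper i j) * m i j.
Proof.
rewrite {1}[m]upper_mx_decomp linear_sum; apply: eq_bigr => i _.
by rewrite linear_sum; apply: eq_bigr => j _; rewrite linearZ mulrC.
Qed.

Definition weighted_sum (d : 'M[R]_n) m : R := \sum_i \sum_j d i j * m i j.

Fact weighted_sum_is_scalar d : scalar (weighted_sum d).
Proof.
move=> x m m'; rewrite /weighted_sum mulr_sumr -big_split.
apply: eq_bigr => i _; rewrite mulr_sumr -big_split; apply: eq_bigr => j _.
by rewrite upper_mxD upper_mxZ mulrDr mulrCA.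
Qed.

HB.instance Definition _ d :=
  GRing.isLinear.Build R (upper_mx R n) R *%R (weighted_sum d)
    (weighted_sum_is_scalar d).

Lemma hook_sumE m i :
  hook_sum m i = \sum_j m i j - \sum_(j | j != i) m j i.
Proof.
rewrite /hook_sum [in RHS](bigD1 i) //=; congr (_ + _ - _).
  rewrite [RHS](bigID (fun j : 'I_n => (i < j)%N)) /= [X in _ + X]big1 ?addr0.
    by apply: eq_bigl => j; rewrite -val_eqE /=; lia.
  by move=> j; rewrite -val_eqE /= => ?; rewrite upper_mx_eq0 //; lia.
rewrite [RHS](bigID (fun j : 'I_n => (j < i)%N)) /= [X in _ + X]big1 ?addr0.
  by apply: eq_bigl => j; rewrite -val_eqE /=; lia.
by move=> j; rewrite -val_eqE /= => ?; rewrite upper_mx_eq0 //; lia.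
Qed.

(** Summation by parts: node weights become edge weights. The sink has weight 0, so a diagonal entry
    keeps the full weight [p i]. *)
Lemma sum_hook_sum (p : 'I_n -> R) m :
  \sum_i p i * hook_sum m i =
  \sum_i \sum_j (p i - (j != i)%:R * p j) * m i j.
Proof.
under eq_bigr => i _.
  rewrite hook_sumE mulrBr !mulr_sumr [X in _ - X]big_mkcond; over.
rewrite sumrB [X in _ - X]exchange_big -sumrB.
apply: eq_bigr => i _; rewrite -sumrB; apply: eq_bigr => j _.
by rewrite mulrBl eq_sym; case: (j != i); rewrite /= ?mul1r ?mul0r.
Qed.

Lemma FlowP (a : 'rV[R]_n) m :
  Flow a m <-> (forall i, hook_sum m i = a 0 i) /\ forall i j, 0 <= m i j.
Proof.
split=> -[hm m_ge0]; split.
- by move=> i; rewrite -hm mxE.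
- by move=> i j; case: (leqP i j) => [/m_ge0//|/upper_mx_eq0 ->].
- by apply/rowP => i; rewrite mxE hm.
- by move=> i j _; apply: m_ge0.
Qed.

End UpperMatrices.

(** Recursion along a rank [r] done by plain iteration: after k rounds the values at ranks below k
    are final, so n rounds suffice. *)
Lemma iter_fixpoint (T : Type) (n : nat) (r : 'I_n -> nat)
    (F : ('I_n -> T) -> 'I_n -> T) (x0 : 'I_n -> T) :
  (forall i, (r i < n)%N) ->
  (forall x y i, (forall j, (r j < r i)%N -> x j = y j) -> F x i = F y i) ->
  forall i, iter n F x0 i = F (iter n F x0) i.
Proof.
move=> rn FP.
suff st k i : (r i < k)%N -> iter k F x0 i = iter k.+1 F x0 i.
  by move=> i; apply: st.
elim: k i => // k IH i ik; apply: FP => j ji; apply: IH.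
exact: leq_trans ji _.
Qed.

(** * Tree flows, reduced costs and the deformation criterion *)

Section TreeFlows.
Variables (R : realType) (n : nat).
Implicit Types (a : 'rV[R]_n) (f : {ffun 'I_n -> 'I_n}) (i j : 'I_n).
Implicit Types (m w x y : upper_mx R n) (c : {scalar upper_mx R n}).

(* A routing sends everything that reaches [i] on to [f i]; [f i = i] stands for
   the sink, matching the role of the diagonal entries. *)
Definition routing f : bool := [forall i : 'I_n, (i <= f i)%N].

Lemma routingP f : reflect (forall i, (i <= f i)%N) (routing f).
Proof. exact: forallP. Qed.

Definition throughput a f : 'I_n -> R :=
  iter n (fun t i => a 0 i + \sum_(j < n | (j < i)%N && (f j == i)) t j)
    (fun=> 0).

Lemma throughputE a f i :
  throughput a f i =
  a 0 i + \sum_(j < n | (j < i)%N && (f j == i)) throughput a f j.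
Proof.
apply: (@iter_fixpoint _ _ (@nat_of_ord n)) => // t u k tu; congr (_ + _).
by apply: eq_bigr => j /andP[jk _]; apply: tu.
Qed.

Lemma throughput_ge a f i :
  (forall j, 0 <= a 0 j) -> a 0 i <= throughput a f i.
Proof.
move=> a_ge0; have [k] := ubnP (i : nat).
elim: k i => // k IH i ik; rewrite throughputE lerDl.
apply: sumr_ge0 => j /andP[ji _].
by apply: (le_trans (a_ge0 j)); apply: IH; exact: leq_trans ji _.
Qed.

Definition tree_flow a f : upper_mx R n :=
  to_upper (fun i j => if j == f i then throughput a f i else 0).

Lemma tree_flowE a f i j : routing f ->
  tree_flow a f i j = if j == f i then throughput a f i else 0.
Proof.
move=> /routingP /(_ i) fi; rewrite to_upperE.
by case: eqP => [->|_]; rewrite ?fi ?if_same.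
Qed.

Lemma tree_flow_hook a f i : routing f -> hook_sum (tree_flow a f) i = a 0 i.
Proof.
move=> rf; rewrite hook_sumE.
under eq_bigr => j _ do rewrite tree_flowE //.
under [X in _ - X]eq_bigr => j _ do rewrite tree_flowE //.
rewrite -big_mkcond big_pred1_eq -big_mkcondr /= throughputE.
rewrite (eq_bigl (fun j : 'I_n => (j < i)%N && (f j == i))) ?addrK // => j.
move/routingP: rf => /(_ j); rewrite eq_sym [f j == i]eq_sym.
by case: (i =P f j) => [->|]; rewrite ?andbF // !andbT -val_eqE /=; lia.
Qed.

Lemma tree_flow_Flow a f :
  routing f -> (forall j, 0 <= a 0 j) -> Flow a (tree_flow a f).
Proof.
move=> rf a_ge0; apply/FlowP; split=> [i|i j]; first exact: tree_flow_hook.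
rewrite tree_flowE //; case: ifP => // _.
exact: le_trans (a_ge0 i) (throughput_ge _ _ _).
Qed.

(* The value, under [c], of routing one unit from [i] to the sink along [f]. *)
Definition potential c f : 'I_n -> R :=
  iter n (fun p i => c (unit_upper R i (f i)) + (f i != i)%:R * p (f i))
    (fun=> 0).

Lemma potentialE c f i : routing f ->
  potential c f i =
  c (unit_upper R i (f i)) + (f i != i)%:R * potential c f (f i).
Proof.
move=> /routingP rf.
apply: (@iter_fixpoint _ _ (fun k : 'I_n => (n - k.+1)%N)) => [k|p q k pq].
  by have := ltn_ord k; lia.
congr (_ + _); case: eqP => [_|/eqP]; first by rewrite !mul0r.
rewrite -val_eqE /= => fk; rewrite pq //.
by have := ltn_ord (f k); have := rf k; lia.
Qed.

(** The slack of the dual linear program: what [c] loses per unit sent first along (i, j) and then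
    along [f], instead of along [f] from [i] on. *)
Definition reduced_cost c f i j : R :=
  potential c f i - (j != i)%:R * potential c f j - c (unit_upper R i j).

Lemma reduced_cost_routing c f i : routing f -> reduced_cost c f i (f i) = 0.
Proof. by move=> rf; rewrite /reduced_cost {1}potentialE //; ring. Qed.

Lemma scalar_reduced_cost c f a m : (forall i, hook_sum m i = a 0 i) ->
  c m = \sum_i potential c f i * a 0 i
        - \sum_i \sum_j reduced_cost c f i j * m i j.
Proof.
move=> hm; under eq_bigr => i _ do rewrite -hm.
rewrite sum_hook_sum -sumrB scalarE; apply: eq_bigr => i _.
by rewrite -sumrB; apply: eq_bigr => j _; rewrite /reduced_cost; ring.
Qed.

(** Rerouting the single node [i] to [j] lowers [c] by the reduced cost times the new throughput at
    [i], which is positive because [a] is. *)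
Lemma reduced_cost_ge0 c f a : (forall i, 0 < a 0 i) -> routing f ->
  (forall g, routing g -> c (tree_flow a g) <= c (tree_flow a f)) ->
  forall i j, (i <= j)%N -> 0 <= reduced_cost c f i j.
Proof.
move=> a_gt0 rf opt i j ij.
pose g := [ffun k => if k == i then j else f k].
have rg : routing g.
  by apply/routingP => k; rewrite ffunE; case: eqP => [->//|_]; apply/routingP.
have hook h (rh : routing h) k := tree_flow_hook a k rh.
have := opt g rg; rewrite !(@scalar_reduced_cost c f a); try exact: hook.
rewrite lerD2l lerN2.
have -> : \sum_k \sum_l reduced_cost c f k l * tree_flow a f k l = 0.
  rewrite big1 // => k _; rewrite big1 // => l _; rewrite tree_flowE //.
  by case: eqP => [->|_]; rewrite ?reduced_cost_routing ?mul0r ?mulr0.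
rewrite (big_only1 i) // => [|k ki _]; last first.
  rewrite big1 // => l _; rewrite tree_flowE // ffunE (negbTE ki).
  by case: eqP => [->|_]; rewrite ?reduced_cost_routing ?mul0r ?mulr0.
rewrite (big_only1 j) // => [|l lj _]; last first.
  by rewrite tree_flowE // ffunE eqxx (negbTE lj) mulr0.
rewrite tree_flowE // ffunE !eqxx pmulr_lge0 //.
by apply: (lt_le_trans (a_gt0 i)); apply: throughput_ge => k; apply: ltW.
Qed.

Definition minimal_off a f w : Prop :=
  Flow a w /\
  forall y, Flow a y -> forall i j, (i <= j)%N -> j != f i -> w i j <= y i j.

Lemma minimal_off_tree_flow a f : routing f -> (forall j, 0 <= a 0 j) ->
  minimal_off a f (tree_flow a f).
Proof.
move=> rf a_ge0; split; first exact: tree_flow_Flow.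
move=> y /FlowP[_ y_ge0] i j _ jf.
by rewrite tree_flowE // (negbTE jf).
Qed.

(** Complementary slackness: the reduced costs vanish along [f] and are nonnegative off [f], where
    [w] is smallest. *)
Lemma minimal_off_optimal a c f w : routing f ->
  (forall i j, (i <= j)%N -> 0 <= reduced_cost c f i j) ->
  minimal_off a f w -> forall y, Flow a y -> c y <= c w.
Proof.
move=> rf d_ge0 [/FlowP[hw w_ge0] wmin] y Fy; have /FlowP[hy y_ge0] := Fy.
rewrite !(@scalar_reduced_cost c f a) // lerD2l lerN2.
apply: ler_sum => i _; apply: ler_sum => j _.
have [ij|ji] := leqP i j; last by rewrite !upper_mx_eq0.
have [->|jf] := eqVneq j (f i); first by rewrite reduced_cost_routing // !mul0r.
by apply: ler_wpM2l; [exact: d_ge0|exact: wmin].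
Qed.

(* The best of the finitely many tree flows has nonnegative reduced costs, so it
   is optimal among all flows. *)
Lemma exists_optimal_tree_flow a c : (forall i, 0 < a 0 i) ->
  exists2 f, routing f & forall y, Flow a y -> c y <= c (tree_flow a f).
Proof.
move=> a_gt0; have r1 : routing [ffun i => i].
  by apply/routingP => i; rewrite ffunE.
case: (@arg_maxP _ _ _ _ routing (fun f => c (tree_flow a f)) r1) => f rf fmax.
exists f => // y Fy; apply: (minimal_off_optimal rf) Fy.
  exact: (@reduced_cost_ge0 c f a).
by apply: minimal_off_tree_flow => // i; apply: ltW.
Qed.

(** The sum of the generators [- m i j] off [f]: one functional whose maximal face detects
    simultaneous minimality of all these entries. *)
Definition off_weight f : 'M[R]_n :=
  \matrix_(i, j) - ((i <= j)%N && (j != f i))%:R.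

Lemma minimal_off_max_face a f w x : minimal_off a f w ->
  max_face (Flow a) (weighted_sum (off_weight f)) x <-> minimal_off a f x.
Proof.
move=> [Fw wmin]; split=> [[Fx xmax]|[Fx xmin]]; last first.
  split=> // y Fy; rewrite /= /weighted_sum.
  apply: ler_sum => i _; apply: ler_sum => j _; rewrite !mxE !mulNr lerN2.
  by case: andP => [[ij jf]|_]; rewrite ?mul1r ?mul0r //; apply: xmin.
split=> // y Fy i j ij jf; apply: le_trans (wmin _ Fy _ _ ij jf).
(* No term is larger at [x] than at [w], so a total that is no smaller forces equality in the term
   (i, j). *)
have := xmax _ Fw; rewrite /= /weighted_sum -subr_ge0 -sumrB.
under eq_bigr => k _ do rewrite -sumrB.
rewrite pair_big /= (bigD1 (i, j)) //= !mxE ij jf => le0.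
suff : \sum_(p | p != (i, j))
    (off_weight f p.1 p.2 * x p.1 p.2 - off_weight f p.1 p.2 * w p.1 p.2) <= 0.
  by move: le0; rewrite /= !mulN1r; set S := \sum_(_ | _) _; lra.
apply: sumr_le0 => -[k l] _ /=; rewrite !mxE !mulNr.
case: andP => [[kl lf]|_]; last by rewrite !mul0r; lra.
by have := wmin _ Fx _ _ kl lf; rewrite !mul1r; lra.
Qed.

Lemma deformationP a0 a : (forall i, 0 < a0 0 i) ->
  is_deformation (Flow a) (Tes a0) <->
  forall f, routing f -> exists w, minimal_off a f w.
Proof.
move=> a0_gt0; have a0_ge0 i : 0 <= a0 0 i by apply: ltW.
split=> [[ref _] f rf|star].
  have vmin := minimal_off_tree_flow rf a0_ge0.
  pose c := weighted_sum (off_weight f) : {scalar upper_mx R n}.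
  have [] := ref (normal_cone (Tes a0) (max_face (Tes a0) c)).
    exists (max_face (Tes a0) c) => //; split; last by exists c.
    by exists (tree_flow a0 f); apply/(minimal_off_max_face _ vmin).
  (* Any point of this face will do: its cone contains each functional [- m i j] off [f]. *)
  move=> _ [F [[w Fw] [d dF]] ->] sub; exists w.
  have Qw : Flow a w by move: Fw; rewrite dF => -[].
  split=> // y Fy i j ij jf.
  pose e := weighted_sum (- delta_mx i j) : {scalar upper_mx R n}.
  have eE m : e m = - m i j.
    rewrite /e /= /weighted_sum (big_only1 i) // => [|k ki _]; last first.
      by rewrite big1 // => l _; rewrite !mxE (negbTE ki) oppr0 mul0r.
    rewrite (big_only1 j) // => [|l lj _]; last first.
      by rewrite !mxE (negbTE lj) andbF oppr0 mul0r.
    by rewrite !mxE !eqxx mulN1r.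
  have /sub /(_ w y Fw Fy) : normal_cone (Tes a0) (max_face (Tes a0) c) e.
    move=> u v /(minimal_off_max_face _ vmin)[_ umin] Fv; rewrite !eE lerN2.
    exact: umin.
  by rewrite !eE lerN2.
have ref C : normal_fan (Tes a0) C ->
    exists2 D, normal_fan (Flow a) D & C `<=` D.
  move=> [F [[x Fx] [c cF]] ->].
  have [f rf fopt] := exists_optimal_tree_flow c a0_gt0.
  have [w wmin] := star f rf.
  pose d := weighted_sum (off_weight f) : {scalar upper_mx R n}.
  exists (normal_cone (Flow a) (max_face (Flow a) d)).
    exists (max_face (Flow a) d) => //; split; last by exists d.
    by exists w; apply/(minimal_off_max_face _ wmin).
  (* The tree flow along [f] lies in [F], so each [e] in the cone of [F] is maximal there and has
     nonnegative reduced costs along [f]. *)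
  move=> e eC u y /(minimal_off_max_face _ wmin) umin Fy.
  apply: (minimal_off_optimal rf) umin _ Fy.
  apply: (@reduced_cost_ge0 e f a0) => // g rg; apply: eC.
    by rewrite cF; split=> [|z Fz]; [exact: tree_flow_Flow|exact: fopt].
  exact: tree_flow_Flow.
split=> //; apply/seteqP; split=> c [C SC Cc].
  by have [D TD CD] := ref C SC; exists D => //; apply: CD.
(* The fan of [Tes a0] is complete: every functional attains its maximum, at a tree flow. *)
have [f rf fopt] := exists_optimal_tree_flow c a0_gt0.
exists (normal_cone (Tes a0) (max_face (Tes a0) c)).
  exists (max_face (Tes a0) c) => //; split; last by exists c.
  by exists (tree_flow a0 f); split=> //; exact: tree_flow_Flow.
by move=> x y [_ xmax] Fy; apply: xmax.
Qed.

End TreeFlows.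

(** * Partial sums of the netflow; the condition of isolated deficits *)

Section PrefixSums.
Variables (R : realType) (n : nat).
Implicit Types (a : 'rV[R]_n) (f : {ffun 'I_n -> 'I_n}) (h i j k l : 'I_n).
Implicit Types (m w y : upper_mx R n).

Definition prefix_sum a (k : nat) : R := \sum_(i < n | (i < k)%N) a 0 i.

Lemma prefix_sum0 a : prefix_sum a 0 = 0.
Proof. by rewrite /prefix_sum big_pred0. Qed.

Lemma prefix_sumS a i : prefix_sum a i.+1 = prefix_sum a i + a 0 i.
Proof.
rewrite /prefix_sum (bigD1 i) //= addrC; congr (_ + _).
by apply: eq_bigl => j; rewrite -val_eqE /=; lia.
Qed.

(** Flow among the first [k] nodes cancels; what remains leaves them, to a later node or, when
    [j == i], to the sink. *)
Lemma prefix_sum_cut a m (k : nat) : (forall i, hook_sum m i = a 0 i) ->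
  prefix_sum a k =
  \sum_(i < n) \sum_(j < n) ((i < k)%N && ((k <= j)%N || (j == i)))%:R * m i j.
Proof.
move=> hm; have -> : prefix_sum a k = \sum_(i < n) (i < k)%N%:R * hook_sum m i.
  rewrite /prefix_sum big_mkcond; apply: eq_bigr => i _; rewrite hm.
  by case: ifP; rewrite ?mul1r ?mul0r.
rewrite (sum_hook_sum (fun i : 'I_n => (i < k)%N%:R)).
apply: eq_bigr => i _; apply: eq_bigr => j _.
have [ij|ji] := leqP i j; last by rewrite upper_mx_eq0 // !mulr0.
congr (_ * _); have [->|ji] := eqVneq j i; first by rewrite orbT andbT /= mul0r subr0.
rewrite orbF mul1r; case: (ltnP i k) => ik; case: (ltnP j k) => jk /=; rewrite ?subrr ?subr0 //.
by exfalso; lia.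
Qed.

Lemma Flow_prefix_ge0 a m (k : nat) : Flow a m -> 0 <= prefix_sum a k.
Proof.
move=> /FlowP[hm m_ge0]; rewrite (prefix_sum_cut _ hm).
by apply: sumr_ge0 => i _; apply: sumr_ge0 => j _; rewrite mulr_ge0.
Qed.

Lemma Flow_prefix_eq0 a m (k : nat) i j : Flow a m -> prefix_sum a k = 0 ->
  (i < k)%N -> (k <= j)%N -> m i j = 0.
Proof.
move=> /FlowP[hm m_ge0]; rewrite (prefix_sum_cut _ hm) pair_big /= => S0 ik kj.
have := psumr_eq0P _ S0; move=> /(_ _ (i, j)) /=; rewrite ik kj mul1r.
by apply=> // p _; rewrite mulr_ge0.
Qed.

(** Only [i] can feed [j], whose inflow must cover its deficit. *)
Lemma Flow_superdiag_ge a y i j : Flow a y -> j = i.+1 :> nat ->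
  (forall k, (k < i)%N -> y k j = 0) -> - a 0 j <= y i j.
Proof.
move=> /FlowP[hy y_ge0] ji y0; rewrite -hy hook_sumE opprB.
rewrite (big_only1 i); first by rewrite lerBlDr lerDl sumr_ge0.
  by rewrite -val_eqE /=; lia.
move=> k ki kj; case: (ltnP k i) => [/y0//|ik]; apply: upper_mx_eq0.
by move: ki kj; rewrite -!val_eqE /=; lia.
Qed.

(** The last node has no successor; the default [i] sends it to the sink. *)
Definition next_routing : {ffun 'I_n -> 'I_n} :=
  [ffun i : 'I_n => odflt i (insub i.+1)].

Lemma next_routingE i : (i.+1 < n)%N -> next_routing i = i.+1 :> nat.
Proof. by move=> iP; rewrite ffunE insubT. Qed.

Lemma routing_next : routing next_routing.
Proof.
apply/routingP => i; rewrite ffunE; case: insubP => [j _ /= ->|_] //=.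
Qed.

Lemma throughput_next a i : throughput a next_routing i = prefix_sum a i.+1.
Proof.
have [k] := ubnP (i : nat); elim: k i => // k IH i ik.
rewrite throughputE prefix_sumS addrC; congr (_ + _).
case: i ik => -[|i] iP ik.
  by rewrite big_pred0 // prefix_sum0.
have iP' : (i < n)%N by apply: ltnW.
rewrite (big_only1 (Ordinal iP')) /=; first exact: IH.
- by rewrite ltnSn -val_eqE /= next_routingE.
- move=> j; rewrite -!val_eqE /= => ji /andP[ji' /eqP fj].
  by move: fj; rewrite next_routingE; [lia|move: ji; lia].
Qed.

(** The throughputs are partial sums, nonnegative as soon as some flow exists, even if [a] has
    negative entries. *)
Lemma Flow_next a m : Flow a m -> Flow a (tree_flow a next_routing).
Proof.
move=> Fm; have rn := routing_next; apply/FlowP; split=> [i|i j].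
  exact: tree_flow_hook.
rewrite tree_flowE // throughput_next; case: ifP => // _.
exact: Flow_prefix_ge0 Fm.
Qed.

Lemma weighted_sum_unit d i j : (i <= j)%N ->
  weighted_sum d (unit_upper R i j) = d i j.
Proof.
move=> ij; rewrite /weighted_sum (big_only1 i) // => [|k ki _]; last first.
  by rewrite big1 // => l _; rewrite to_upperE (negbTE ki) if_same mulr0.
rewrite (big_only1 j) // => [|l lj _]; last first.
  by rewrite to_upperE (negbTE lj) andbF if_same mulr0.
by rewrite to_upperE ij !eqxx mulr1.
Qed.

Lemma hook_sum_weighted m k :
  hook_sum m k =
  weighted_sum (\matrix_(i, j) ((i == k)%:R - (j != i)%:R * (j == k)%:R)) m.
Proof.
have := sum_hook_sum (fun i => (i == k)%:R) m.
rewrite (big_only1 k) // => [|i ik _]; last by rewrite (negbTE ik) mul0r.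
rewrite eqxx mul1r => ->; apply: eq_bigr => i _; apply: eq_bigr => j _.
by rewrite mxE.
Qed.

Definition shortcut h i j : upper_mx R n :=
  unit_upper R h j - unit_upper R h i - unit_upper R i j.

Lemma hook_sum_shortcut h i j k : (h < i)%N -> (i < j)%N ->
  hook_sum (shortcut h i j) k = 0.
Proof.
move=> hi ij; rewrite hook_sum_weighted !linearB /=.
rewrite !weighted_sum_unit ?(ltnW hi) ?(ltnW ij) ?(ltnW (ltn_trans hi ij)) // !mxE.
have -> : j != h by rewrite -val_eqE /=; lia.
have -> : i != h by rewrite -val_eqE /=; lia.
have -> : j != i by rewrite -val_eqE /=; lia.
by rewrite !mul1r; ring.
Qed.

(* A negative netflow must be paid for by the node just before it alone: no
   other earlier node has anything left to send. *)
Definition isolated_deficits a : Prop :=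
  forall i j, j = i.+1 :> nat -> a 0 j < 0 -> prefix_sum a i = 0.

Lemma isolated_deficits_necessary a m : Flow a m ->
  (forall f, routing f -> exists w, minimal_off a f w) -> isolated_deficits a.
Proof.
move=> Fm star i j ji aj_lt0; apply: contrapT => /eqP s_neq0.
have Fc := Flow_next Fm; have rn := routing_next.
pose f := [ffun k : 'I_n => if (k < i)%N then next_routing k else k].
have rf : routing f.
  apply/routingP => k; rewrite ffunE; case: ifP => // _.
  by move/routingP: rn; apply.
have [w [Fw wmin]] := star f rf; have /FlowP[hw w_ge0] := Fw.
(* Comparison with the flow along [next_routing], which vanishes off that path. *)
have w0 k l : l != f k -> l != next_routing k -> w k l = 0.
  move=> lf ln; case: (leqP k l) => [kl|/upper_mx_eq0//].
  apply/eqP; rewrite eq_le w_ge0 andbT.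
  by apply: le_trans (wmin _ Fc _ _ kl lf) _; rewrite tree_flowE // (negbTE ln).
have w0i k l : (k < i)%N -> l <> k.+1 :> nat -> w k l = 0.
  move=> ki lk.
  have lk' : l != next_routing k.
    apply/eqP => /(congr1 val) /=.
    by rewrite next_routingE //; have := ltn_ord i; lia.
  by apply: w0 => //; rewrite ffunE ki.
(* The nonzero partial sum must leave the nodes before [i], and by [w0i] only the edge into [i] from
   its predecessor can carry it. *)
have [h hi whi] : exists2 h : 'I_n, i = h.+1 :> nat & w h i != 0.
  apply: contrapT => no; move/eqP: s_neq0; apply.
  rewrite (prefix_sum_cut _ hw) big1 // => k _; rewrite big1 // => l _.
  case: andP => [[ki kl]|_]; last by rewrite mul0r.
  rewrite mul1r; apply: contrapT => wkl; apply: no.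
  have lk : l = k.+1 :> nat by apply: contrapT => /(w0i _ _ ki).
  have li : l = i by apply: val_inj; move: kl; rewrite -val_eqE /=; lia.
  by exists k; [rewrite -li|rewrite -li; apply/eqP].
have whi_gt0 : 0 < w h i by rewrite lt_def whi w_ge0.
have wij : - a 0 j <= w i j.
  by apply: Flow_superdiag_ge => // k ki; apply: w0i => //; lia.
have wij_gt0 : 0 < w i j by lra.
(* Sending a little of the flow on h -> i -> j directly from h to j lowers
   the entry (i, j), although it is off the routing [f]. *)
pose d := Num.min (w h i) (w i j).
have d_gt0 : 0 < d by rewrite lt_min whi_gt0.
have [hi' ij'] : (h < i)%N /\ (i < j)%N by lia.
pose y := w + d *: shortcut h i j.
have yE k l : y k l = w k l + d * (((k == h) && (l == j))%:R
    - ((k == h) && (l == i))%:R - ((k == i) && (l == j))%:R).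
  rewrite upper_mxD upper_mxZ; have [kl|lk] := leqP k l.
    by rewrite !mxE kl.
  rewrite !mxE leqNgt lk /= -!val_eqE /=.
  have -> : (k == h :> nat) && (l == j :> nat) = false by lia.
  have -> : (k == h :> nat) && (l == i :> nat) = false by lia.
  have -> : (k == i :> nat) && (l == j :> nat) = false by lia.
  by rewrite !subr0.
have Fy : Flow a y.
  apply/FlowP; split=> [k|k l].
    rewrite hook_sum_weighted linearD linearZ /= -!hook_sum_weighted.
    by rewrite hook_sum_shortcut // mulr0 addr0.
  have d_hi : d <= w h i by rewrite ge_min lexx.
  have d_ij : d <= w i j by rewrite ge_min lexx orbT.
  have := w_ge0 k l; rewrite yE.
  have [->|kh] := eqVneq k h; have [->|lj] := eqVneq l j => /=.
  - have -> : (j == i) = false by rewrite -val_eqE /=; lia.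
    have -> : (h == i) = false by rewrite -val_eqE /=; lia.
    by rewrite /=; lra.
  - by rewrite andbF; have [->|li] := eqVneq l i => /=; lra.
  - by have [->|ki] := eqVneq k i => /=; lra.
  - by rewrite andbF /=; lra.
have jf : j != f i by rewrite ffunE ltnn -val_eqE /=; lia.
have := wmin y Fy i j (ltnW ij') jf; rewrite yE !eqxx.
have -> : (i == h) = false by rewrite -val_eqE /=; lia.
by rewrite /=; lra.
Qed.

Lemma isolated_deficits_sufficient a m f : Flow a m -> isolated_deficits a ->
  routing f -> exists w, minimal_off a f w.
Proof.
move=> Fm iso rf; have s_ge0 (k : nat) := Flow_prefix_ge0 k Fm.
(* [b] collects the amounts that every flow must send to pay for deficits; the netflow [a'] left
   after subtracting it is nonnegative and can be routed along [f]. *)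
pose b : upper_mx R n :=
  to_upper (fun i j => if j == i.+1 :> nat then Num.max 0 (- a 0 j) else 0).
have bE i j : b i j = if j == i.+1 :> nat then Num.max 0 (- a 0 j) else 0.
  by rewrite to_upperE; case: eqP => [->|_]; rewrite ?leqnSn ?if_same.
have b_ge0 i j : 0 <= b i j.
  by rewrite bE; case: ifP => // _; rewrite le_max lexx.
pose a' := a - hook_sums b.
have a'_ge0 i : 0 <= a' 0 i.
  rewrite !mxE hook_sumE opprB.
  have inb : Num.max 0 (- a 0 i) <= \sum_(k | k != i) b k i.
    rewrite ge_max sumr_ge0 //=; have [ai|ai] := leP 0 (a 0 i).
      by apply: (@le_trans _ _ 0); [lra|rewrite sumr_ge0].
    (* The first node has no predecessor, but its netflow is a partial sum and so cannot be
       negative. *)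
    case: i ai => -[|i] iP ai.
      by have := s_ge0 (Ordinal iP).+1; rewrite prefix_sumS prefix_sum0; lra.
    have iP' : (i < n)%N by apply: ltnW.
    rewrite (bigD1 (Ordinal iP')) /=; last by rewrite -val_eqE /=; lia.
    rewrite bE eqxx ler_wpDr ?sumr_ge0 //.
    by rewrite le_max lexx orbT.
  have outb : \sum_j b i j <= Num.max 0 (a 0 i).
    have [iP|iP] := ltnP i.+1 n; last first.
      rewrite big1 ?le_max ?lexx // => j _; rewrite bE.
      by have := ltn_ord j; case: eqP => //; lia.
    rewrite (big_only1 (Ordinal iP)) // => [|j ji _]; last first.
      by rewrite bE; move: ji; rewrite -val_eqE /= => /negbTE ->.
    rewrite bE eqxx ge_max le_max lexx /= le_max.
    have [aj|aj] := leP 0 (a 0 (Ordinal iP)); first by apply/orP; left; lra.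
    (* The partial sum before [i] vanishes, so the netflows of [i] and its successor add up to a
       partial sum, which is nonnegative. *)
    apply/orP; right; have si := iso i (Ordinal iP) erefl aj.
    have := s_ge0 (Ordinal iP).+1.
    by rewrite !(prefix_sumS _ (Ordinal iP)) (prefix_sumS _ i) si; lra.
  by move: inb outb; rewrite !maxEle; do 2!case: ifP; lra.
exists (b + tree_flow a' f); split.
  apply/FlowP; split=> [i|i j]; last first.
    have /FlowP[_ t_ge0] := tree_flow_Flow rf a'_ge0.
    by rewrite upper_mxD addr_ge0.
  rewrite hook_sum_weighted linearD /= -!hook_sum_weighted tree_flow_hook //.
  have -> : a' 0 i = a 0 i - hook_sum b i by rewrite !mxE.
  by rewrite addrC subrK.
move=> y Fy i j ij jf; have /FlowP[_ y_ge0] := Fy.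
rewrite upper_mxD tree_flowE // (negbTE jf) addr0 bE; case: eqP => // ji.
rewrite ge_max y_ge0 /=; have [aj|aj] := leP 0 (a 0 j).
  by apply: le_trans (y_ge0 i j); lra.
apply: Flow_superdiag_ge => // k ki.
by apply: Flow_prefix_eq0 Fy (iso i j ji aj) ki _; lia.
Qed.

(** * The critical position in terms of partial sums *)

Definition critical a i : bool :=
  [&& (i.+1 < n)%N, 0 < a 0 i & ~~ voided_positive a i].

Lemma critical_position_le a i : critical a i -> (critical_position a <= i.+1)%N.
Proof. exact: (@bigmin_le_cond _ nat _ n i (critical a) (fun k => k.+1)). Qed.

Lemma critical_positionP a :
  critical_position a = n \/
  exists2 i, critical a i & critical_position a = i.+1.
Proof.
rewrite /critical_position; elim/big_rec: _ => [|i l ci IH]; first by left.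
rewrite /minn; case: ifP => // _; by right; exists i.
Qed.

Lemma voidedP a i j : j = i.+1 :> nat ->
  voided_positive a i = (0 < a 0 i) && (a 0 i + a 0 j == 0).
Proof.
move=> ji; rewrite /voided_positive; congr (_ && _).
apply/existsP/idP => [[k /andP[/eqP ki]]|aij]; last by exists j; rewrite ji eqxx.
by have -> : k = j by apply: val_inj; rewrite /= ki ji.
Qed.

(** Before the critical position each positive entry is cancelled by the next one, so a partial sum
    is nonzero only between the two. *)
Lemma prefix_sum_before_critical a m (k : nat) : Flow a m ->
  (k < critical_position a)%N ->
  prefix_sum a k = 0 \/
  exists2 i : 'I_n, i = k :> nat & 0 < prefix_sum a k /\ prefix_sum a k + a 0 i = 0.
Proof.
move=> Fm; have s_ge0 (q : nat) := Flow_prefix_ge0 q Fm.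
have l_le_n : (critical_position a <= n)%N.
  by case: (critical_positionP a) => [->|[i _ ->]].
elim: k => [|k IH] kl; first by left; rewrite prefix_sum0.
have kn1 : (k.+1 < n)%N by lia.
have kn : (k < n)%N by lia.
pose i := Ordinal kn; pose j := Ordinal kn1.
have sS : prefix_sum a k.+1 = prefix_sum a k + a 0 i := prefix_sumS a i.
have [s0|[i' i'k [_ s0]]] := IH (ltnW kl); last first.
  by left; rewrite sS; have -> : i = i' by apply: val_inj.
have ai_ge0 : 0 <= a 0 i by have := s_ge0 j; rewrite sS s0 add0r.
have [ai|ai] := eqVneq (a 0 i) 0; first by left; rewrite sS s0 ai addr0.
have ai_gt0 : 0 < a 0 i by rewrite lt_def ai.
right; exists j => //; rewrite sS s0 add0r; split=> //.
have : ~~ critical a i by apply/negP => /critical_position_le; rewrite leqNgt kl.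
rewrite /critical kn1 ai_gt0 negbK (@voidedP a i j) // ai_gt0.
by move/eqP.
Qed.

Lemma isolated_deficitsP a m : Flow a m ->
  isolated_deficits a <->
  (critical_position a = n \/
   forall i, (critical_position a + 2 <= i.+1)%N -> 0 <= a 0 i).
Proof.
move=> Fm; have s_ge0 (k : nat) := Flow_prefix_ge0 k Fm; split=> [iso|rhs i j ji aj].
  case: (critical_positionP a) => [|[i0 ci0 ->]]; first by left.
  right=> i li; move/and3P: ci0 => [i0n ai0 void].
  (* From the critical entry on, partial sums stay positive: a later deficit would require an
     earlier partial sum to vanish. *)
  have s_gt0 (k : nat) : (i0 < k)%N -> (k <= n)%N -> 0 < prefix_sum a k.
    elim/ltn_ind: k => k IH i0k kn.
    have [->|k1] := eqVneq k i0.+1.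
      by rewrite prefix_sumS; have := s_ge0 i0; lra.
    have jP : (k.-1 < n)%N by lia.
    have iP : (k.-2 < n)%N by lia.
    pose j := Ordinal jP; pose h := Ordinal iP.
    have jh : j = h.+1 :> nat by rewrite /=; lia.
    have kj : k = j.+1 by rewrite /=; lia.
    have [aj|aj] := leP 0 (a 0 j).
      rewrite kj prefix_sumS; apply: ltr_wpDr => //.
      by apply: IH; rewrite /=; lia.
    have sh := iso h j jh aj.
    (* A deficit right after [i0] is the one case that induction does not exclude; there the sum is
       nonzero because [i0] is not voided. *)
    have [k2|k2] := eqVneq k i0.+2; last first.
      have : 0 < prefix_sum a h by apply: IH => /=; lia.
      by rewrite sh ltxx.
    have hi0 : h = i0 by apply: val_inj; rewrite /=; lia.
    rewrite hi0 in sh jh; move: void; rewrite (voidedP _ jh) ai0 /= => void.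
    rewrite lt_def s_ge0 andbT kj prefix_sumS jh prefix_sumS sh add0r.
    exact: void.
  have [//|ai] := leP 0 (a 0 i).
  have hP : (i.-1 < n)%N by have := ltn_ord i; lia.
  have ih : i = (Ordinal hP).+1 :> nat by rewrite /=; lia.
  have : 0 < prefix_sum a (Ordinal hP) by apply: s_gt0 => /=; lia.
  by rewrite (iso _ _ ih ai) ltxx.
have il : (i < critical_position a)%N.
  case: rhs => [->|/(_ j) rhs]; first by have := ltn_ord j; lia.
  by rewrite ltnNge; apply/negP => li; move: aj; rewrite ltNge rhs //; lia.
(* If the entry at [i] cancelled a positive partial sum, the deficit at [j] would make the next one
   negative. *)
have [//|[k /val_inj -> [_ si]]] := prefix_sum_before_critical Fm il.
by have := s_ge0 j.+1; rewrite prefix_sumS ji prefix_sumS si add0r; lra.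
Qed.

End PrefixSums.

Theorem theorem1p2 (R : realType) (n : nat) (n_gt0 : (0 < n)%N)
    (a0 a : 'rV[R]_n) (a0_gt0 : forall i : 'I_n, 0 < a0 0 i)
    (Flow_nonempty : Flow a !=set0)
    (l : nat) (l_crit : l = critical_position a) :
  is_deformation (Flow a) (Tes a0) <->
  (l = n \/ forall i : 'I_n, (l + 2 <= i.+1)%N -> 0 <= a 0 i).
Proof.
have [m Fm] := Flow_nonempty.
rewrite l_crit -(isolated_deficitsP Fm) (deformationP a a0_gt0).
split=> [|iso f]; first exact: isolated_deficits_necessary Fm.
exact: isolated_deficits_sufficient Fm iso.
Qed.
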